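(* Let $G=(V,E)$ be a graph containing three mutually adjacent vertices $A,B,C$. For $X\in\{A,B,C\}$ let $\mathcal N'_X=\mathcal N_X\setminus\{A,B,C\}$, where $\mathcal N_X$ is the neighbourhood of $X$, and define $T_{ABC}=\mathcal N'_A\cap\mathcal N'_B\cap\mathcal N'_C$, $J_{XY}=(\mathcal N'_X\cap\mathcal N'_Y)\setminus T_{ABC}$ for $X\ne Y$, and $E_X=\mathcal N'_X\setminus(\mathcal N'_Y\cup\mathcal N'_Z)$ where $\{X,Y,Z\}=\{A,B,C\}$. Then the graph state $|G\rangle$ cannot be prepared in any network with only bipartite sources if one of the following holds: (1) $J_{XY}=J_{XZ}=\emptyset$ for some permutation $X,Y,Z$ of $A,B,C$; (2) $E_X=E_Y=\emptyset$ for some $X\ne Y\in\{A,B,C\}$; (3) $E_X=J_{XY}=\emptyset$ for some $X\neq Y\in\{A,B,C\}$.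
   Context: Graph states: for a graph $G=(V,E)$ with $N$ vertices, each vertex is a qubit; for $i\in V$ with neighbourhood $\mathcal N_i$, $g_i=X_i\prod_{j\in\mathcal N_i}Z_j$, and $|G\rangle$ is the unique common $+1$ eigenvector of all $g_i$. Network states: $N$ parties, one per vertex, each finally holding one qubit. A network with bipartite sources is a finite collection of sources, each associated with at most two parties, emitting a state (finite-dimensional, arbitrary dimension) whose subsystems go one to each associated party. A state $\varrho$ can be prepared in the network if $\varrho=\sum_\lambda p_\lambda\bigotimes_X\mathcal E_X^{(\lambda)}[\bigotimes_s\varrho_s]$ with a probability distribution $p_\lambda$, source states $\varrho_s$ and quantum channels $\mathcal E_X^{(\lambda)}$ acting on everything party $X$ received. *)

(* Defs.v *)
From mathcomp Require Import all_boot all_order all_algebra.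
From mathcomp Require Import complex.
From mathcomp Require Import Rstruct.
Set Implicit Arguments. Unset Strict Implicit. Unset Printing Implicit Defensive.
Import Order.TTheory GRing.Theory Num.Theory.
Local Open Scope ring_scope.

Definition Cplx : numClosedFieldType := (Rdefinitions.R)[i]%C.

(* a (density) operator on C^T, given by its matrix entries *)
Definition dop (T : finType) := T -> T -> Cplx.

(* density operator: positive semidefinite (hence Hermitian) and trace one.
   In Cplx, [0 <= z] means that z is real and nonnegative. *)
Definition is_state (T : finType) (rho : dop T) : Prop :=
  (forall v : T -> Cplx, 0 <= \sum_(i : T) \sum_(j : T) (v i)^* * rho i j * v j)
  /\ \sum_(i : T) rho i i = 1.

(* computational-basis labels of N qubits (qubit i <-> vertex/party i) *)
Definition qubits (N : nat) := {ffun 'I_N -> bool}.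

Definition flip (N : nat) (i : 'I_N) (x : qubits N) : qubits N :=
  [ffun j => if j == i then ~~ x j else x j].

Definition Xop (N : nat) (i : 'I_N) (psi : qubits N -> Cplx) : qubits N -> Cplx :=
  fun x => psi (flip i x).
Definition Zop (N : nat) (j : 'I_N) (psi : qubits N -> Cplx) : qubits N -> Cplx :=
  fun x => (-1) ^+ (x j) * psi x.

Definition nbhd (N : nat) (e : rel 'I_N) (i : 'I_N) : {set 'I_N} := [set j | e i j].

Definition gop (N : nat) (e : rel 'I_N) (i : 'I_N) (psi : qubits N -> Cplx)
  : qubits N -> Cplx :=
  Xop i (foldr (fun j phi => Zop j phi) psi (enum (nbhd e i))).

(* psi is a normalized common +1 eigenvector of all g_i, i.e. (up to a global
   phase) the graph state |G>; its density operator is |psi><psi|. *)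
Definition is_graph_state_vector (N : nat) (e : rel 'I_N) (psi : qubits N -> Cplx)
  : Prop :=
  \sum_(x : qubits N) (psi x)^* * psi x = 1 /\ forall i : 'I_N, gop e i psi = psi.

Definition proj_of (N : nat) (psi : qubits N -> Cplx) : dop (qubits N) :=
  fun x y => psi x * (psi y)^*.

(* A network on parties 'I_N has S sources; source s sends its first    *)
(* subsystem (dimension d1 s) to party a s and its second subsystem     *)
(* (dimension d2 s) to party b s.  A source associated with a single     *)
(* party X is the case a s = b s = X.                                   *)

(* joint basis labels of all emitted subsystems *)
Definition slot (m n : nat) : finType := prod 'I_m 'I_n.
Definition srcconf (S : nat) (d1 d2 : 'I_S -> nat) :=
  {dffun forall s : 'I_S, slot (d1 s) (d2 s)}.

Definition src_state (S : nat) (d1 d2 : 'I_S -> nat)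
  (rho : forall s : 'I_S, dop (slot (d1 s) (d2 s))) : dop (srcconf d1 d2) :=
  fun c c' => \prod_(s : 'I_S) rho s (c s) (c' s).

Definition agree_on (N S : nat) (a b : 'I_S -> 'I_N) (d1 d2 : 'I_S -> nat)
  (X : 'I_N) (c c' : srcconf d1 d2) : bool :=
  [forall s : 'I_S, ((a s == X) ==> ((c s).1 == (c' s).1))
                    && ((b s == X) ==> ((c s).2 == (c' s).2))].

(* K : 'I_M -> bool -> srcconf -> Cplx is a family of M Kraus operators of a
   quantum channel from the system received by party X (everything X gets
   from the sources) to one qubit: entry K k o c = <o| K_k |c restricted to X>.
   - locality: K k o c depends only on the subsystems received by X;
   - completeness: sum_k K_k^dagger K_k = identity on X's input space. *)
Definition local_channel (N S : nat) (a b : 'I_S -> 'I_N) (d1 d2 : 'I_S -> nat)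
  (X : 'I_N) (M : nat) (K : 'I_M -> bool -> srcconf d1 d2 -> Cplx) : Prop :=
  (forall k o c c', agree_on a b X c c' -> K k o c = K k o c')
  /\ (forall c c', \sum_(k < M) \sum_(o : bool) (K k o c)^* * K k o c'
                   = if agree_on a b X c c' then 1 else 0).

(* output of (tensor)_X E_X [(tensor)_s rho_s], E_X having Kraus operators K X _ *)
Definition network_output (N S : nat) (d1 d2 : 'I_S -> nat) (M : nat)
  (K : 'I_N -> 'I_M -> bool -> srcconf d1 d2 -> Cplx) (sigma : dop (srcconf d1 d2))
  : dop (qubits N) :=
  fun o o' =>
    \sum_(k : {ffun 'I_N -> 'I_M}) \sum_(c : srcconf d1 d2) \sum_(c' : srcconf d1 d2)
      (\prod_(X : 'I_N) K X (k X) (o X) c) * sigma c c'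
      * (\prod_(X : 'I_N) K X (k X) (o' X) c')^*.

Definition preparable_bipartite (N : nat) (target : dop (qubits N)) : Prop :=
  exists (S : nat) (a b : 'I_S -> 'I_N) (d1 d2 : 'I_S -> nat)
         (rho : forall s : 'I_S, dop (slot (d1 s) (d2 s))),
    (forall s, is_state (rho s)) /\
    exists (L : nat) (p : 'I_L -> Cplx) (M : nat)
           (K : 'I_L -> 'I_N -> 'I_M -> bool -> srcconf d1 d2 -> Cplx),
      (forall l, 0 <= p l) /\ \sum_(l < L) p l = 1 /\
      (forall l X, local_channel a b X (K l X)) /\
      target = (fun o o' => \sum_(l < L) p l *
                 network_output (K l) (src_state rho) o o').

Section Triangle.
Variables (N : nat) (e : rel 'I_N) (A B C : 'I_N).

Definition tri : {set 'I_N} := [set A; B; C].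

Definition Nprime (X : 'I_N) : {set 'I_N} := nbhd e X :\: tri.

Definition Tset : {set 'I_N} := Nprime A :&: Nprime B :&: Nprime C.

Definition Jset (X Y : 'I_N) : {set 'I_N} := (Nprime X :&: Nprime Y) :\: Tset.

Definition Eset (X : 'I_N) : {set 'I_N} :=
  Nprime X :\: \bigcup_(W in tri :\ X) Nprime W.

End Triangle.

(* Main.v *)
(** Fix a triangle A, B, C. The stabilizer elements g_A g_B, g_B g_C and
    g_A g_C act trivially on C, A and B respectively. Take two copies of the
    network and rewire them so that C no longer shares a source with A of its
    own copy. This is invisible to any Pauli string that is trivial on A or on
    C, so g_A g_B and g_B g_C keep expectation value 1, hence so does their
    product g_A g_C up to sign, even though A and C share no source.

    As g_A g_C is trivial on B, this persists in a second rewiring, where it is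
    measured on A of the first copy and C of the second copy, the latter taking
    from the first copy only its connections with the remaining support
    { v | A~v xor C~v } of g_A g_C. A stabilizer element trivial on that set can
    be measured in the same rewired network on A, B, C of the first copy, and
    keeps expectation value 1. If it anticommutes with g_A g_C at A the two
    strings anticommute, since they meet nowhere else but in Z factors: a
    contradiction. The three conditions provide such elements, namely (with
    suitable names of the vertices) g_B, g_A g_B g_C and g_A.

    Signs of Pauli strings are never tracked: an expectation value of modulus
    one suffices. *)
Require Import Defs.
From mathcomp Require Import all_boot all_order all_algebra.
From mathcomp Require Import complex spectral.
From mathcomp Require Import ring.
Set Implicit Arguments. Unset Strict Implicit. Unset Printing Implicit Defensive.
Import GRing.Theory Num.Theory.
Local Open Scope ring_scope.
Local Open Scope sesquilinear_scope.

(* Otherwise simplification unfolds [Cplx] and breaks the inference of its ring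
   structure. *)
Local Opaque Cplx.

(** * Positive semidefinite kernels as Gram kernels *)

Section Gram.
Variable F : numClosedFieldType.

Definition psd (T : finType) (rho : T -> T -> F) :=
  forall v : T -> F, 0 <= \sum_i \sum_j (v i)^* * rho i j * v j.

Definition is_gram (T : Type) (rho : T -> T -> F) :=
  exists (J : finType) (w : J -> T -> F),
    forall x y, rho x y = \sum_j w j x * (w j y)^*.

Lemma sum_delta (T : finType) (a : T) (f : T -> F) :
  \sum_i (i == a)%:R * f i = f a.
Proof.
rewrite (bigD1 a) //= eqxx mul1r big1 ?addr0 // => i /negPf ->.
by rewrite mul0r.
Qed.

(** Polarisation: the form is real at $e_c + w e_d$, and $w = 0, 1, i$ separate the diagonal and the
    two off-diagonal entries. *)
Lemma psd_hermitian (T : finType) (rho : T -> T -> F) :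
  psd rho -> forall a b, (rho b a)^* = rho a b.
Proof.
move=> rho_psd a b.
have qreal c d w :
    let q := rho c c + w * rho c d + w^* * rho d c + w^* * w * rho d d in
    q^* = q.
  move=> q; have -> : q = \sum_i \sum_j ((i == c)%:R + w * (i == d)%:R)^* *
      rho i j * ((j == c)%:R + w * (j == d)%:R).
    have inner u i : \sum_j u * rho i j * ((j == c)%:R + w * (j == d)%:R) =
        u * rho i c + w * (u * rho i d).
      rewrite -[u * _](sum_delta c (fun j => u * rho i j)).
      rewrite -[u * _ in RHS](sum_delta d (fun j => u * rho i j)).
      rewrite mulr_sumr -big_split; apply: eq_bigr => j _ /=; ring.
    under eq_bigr do rewrite inner.
    have -> : q = (rho c c + w * rho c d) + w^* * (rho d c + w * rho d d).
      by rewrite /q; ring.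
    rewrite -(sum_delta c (fun i => rho i c + w * rho i d)).
    rewrite -(sum_delta d (fun i => rho i c + w * rho i d)).
    rewrite mulr_sumr -big_split; apply: eq_bigr => i _ /=.
    by rewrite rmorphD rmorphM /= !conjC_nat; ring.
  by apply/CrealP/ger0_real/rho_psd.
have diag c : (rho c c)^* = rho c c.
  by have /= := qreal c c 0; rewrite conjC0 !mul0r !addr0.
have := qreal a b 'i; have := qreal a b 1.
rewrite /= conjC1 conjCi !mul1r !mulNr -expr2 sqrCi mulN1r opprK.
rewrite !(rmorphD, rmorphN, rmorphM) /= !diag !conjCi.
move=> E1 E2.
have {}E1 : (rho a b)^* + (rho b a)^* = rho a b + rho b a.
  apply: (addrI (rho a a)); apply: (addIr (rho b b)).
  by rewrite !addrA.
have {}E2 : (rho b a)^* - (rho a b)^* = rho a b - rho b a.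
  apply: (mulfI (neq0Ci F)); apply: (addrI (rho a a)); apply: (addIr (rho b b)).
  rewrite !mulrBr !addrA -[RHS]E2; ring.
apply: (@mulfI _ 2%:R); first by rewrite pnatr_eq0.
have -> : 2%:R * (rho b a)^* =
   ((rho a b)^* + (rho b a)^*) + ((rho b a)^* - (rho a b)^*) by ring.
rewrite E1 E2; ring.
Qed.

(** Spectral theorem: each eigenvalue is the value of the form at an eigenvector, hence nonnegative;
    eigenvectors scaled by the square roots of their eigenvalues form the Gram family. *)
Lemma psd_gram (T : finType) (rho : T -> T -> F) : psd rho -> is_gram rho.
Proof.
move=> rho_psd; pose n := #|T|.
pose A : 'M[F]_n := \matrix_(i, j) rho (enum_val i) (enum_val j).
have A_herm : A ^t* = A.
  by apply/matrixP => i j; rewrite !mxE (psd_hermitian rho_psd).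
have /orthomx_spectralP A_eq : A \is normalmx.
  by apply/normalmxP; rewrite A_herm.
pose P := spectralmx A; have P_unitary : P \is unitarymx.
  exact: spectral_unitarymx.
rewrite -/P invmx_unitary // in A_eq.
pose D := spectral_diag A; rewrite -/D in A_eq.
have D_ge0 k : 0 <= D 0 k.
  have PAP : P *m A *m P ^t* = diag_mx D.
    have /unitarymxP PP := P_unitary.
    by rewrite {1}A_eq -!mulmxA PP mulmx1 !mulmxA PP mul1mx.
  have <- : (P *m A *m P ^t*) k k = D 0 k.
    by rewrite PAP mxE eqxx.
  have := rho_psd (fun i => (P k (enum_rank i))^*).
  congr (0 <= _); rewrite mxE.
  rewrite [LHS]exchange_big /= (reindex (@enum_val T predT)) /=; last first.
    by apply/onW_bij/enum_val_bij.
  apply: eq_bigr => j _; rewrite !mxE mulr_suml.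
  rewrite (reindex (@enum_val T predT)) /=; last first.
    by apply/onW_bij/enum_val_bij.
  apply: eq_bigr => i _.
  by rewrite !mxE !enum_valK conjCK.
exists 'I_n, (fun k x => sqrtC (D 0 k) * (P k (enum_rank x))^*) => x y.
have -> : rho x y = A (enum_rank x) (enum_rank y).
  by rewrite mxE !enum_rankK.
rewrite A_eq mxE; apply: eq_bigr => k _.
rewrite mul_mx_diag !mxE rmorphM /= conjCK.
rewrite -[in LHS](sqrtCK (D 0 k)) expr2.
have /CrealP -> : sqrtC (D 0 k) \is Num.real by rewrite ger0_real ?sqrtC_ge0.
ring.
Qed.

Lemma is_gram_pullback (T U : Type) (f : T -> U) (rho : U -> U -> F) :
  is_gram rho -> is_gram (fun x y => rho (f x) (f y)).
Proof. by case=> J [w rhoE]; exists J, (fun j x => w j (f x)) => x y. Qed.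

Lemma is_gram1 (T : Type) : is_gram (fun _ _ : T => 1).
Proof.
exists unit, (fun _ _ => 1) => x y.
by rewrite big_const card_unit /= conjC1 mulr1 addr0.
Qed.

(** Schur's product theorem; it serves to combine independent sources. *)
Lemma is_gramM (T : Type) (rho sigma : T -> T -> F) :
  is_gram rho -> is_gram sigma -> is_gram (fun x y => rho x y * sigma x y).
Proof.
move=> [J [w rhoE]] [J' [w' sigmaE]].
exists (J * J')%type, (fun j x => w j.1 x * w' j.2 x) => x y.
rewrite rhoE sigmaE mulr_suml -(pair_bigA _ (fun j j' =>
  w j x * w' j' x * (w j y * w' j' y)^*)) /=.
apply: eq_bigr => j _; rewrite mulr_sumr; apply: eq_bigr => j' _.
by rewrite rmorphM /=; ring.
Qed.

Lemma is_gram_prod (T : Type) (I : finType) (rho : I -> T -> T -> F) :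
  (forall i, is_gram (rho i)) -> is_gram (fun x y => \prod_i rho i x y).
Proof.
move=> rho_gram.
suff gram_seq (r : seq I) : is_gram (fun x y => \prod_(i <- r) rho i x y).
  by have [J [w wE]] := gram_seq (index_enum I); exists J, w.
elim: r => [|i r IHr].
  have [J [w wE]] := is_gram1 T.
  by exists J, w => x y; rewrite big_nil (wE x y).
have [J [w wE]] := is_gramM (rho_gram i) IHr.
by exists J, w => x y; rewrite big_cons (wE x y).
Qed.

End Gram.

(** * Pauli strings and their expectation values *)

Section PauliStrings.
Variables (F : numClosedFieldType) (I : finType).
Implicit Types x z o : {ffun I -> bool}.

Definition xorf x z : {ffun I -> bool} := [ffun p => x p (+) z p].

Definition sgn z o : F := \prod_p (-1) ^+ (z p && o p).

Definition pm1 (a : F) := (a == 1) || (a == -1).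

Lemma xorfC x z : xorf x z = xorf z x.
Proof. by apply/ffunP => p; rewrite !ffunE addbC. Qed.

Lemma xorfA x y z : xorf x (xorf y z) = xorf (xorf x y) z.
Proof. by apply/ffunP => p; rewrite !ffunE addbA. Qed.

Lemma xorfK x : involutive (xorf^~ x).
Proof. by move=> o; apply/ffunP => p; rewrite !ffunE addbK. Qed.

Lemma pm1_mul a b : pm1 a -> pm1 b -> pm1 (a * b).
Proof.
by case/orP=> /eqP-> /orP[] /eqP->;
  rewrite /pm1 ?mulN1r ?mul1r ?opprK eqxx ?orbT.
Qed.

Lemma pm1_sqr a : pm1 a -> a * a = 1.
Proof. by case/orP=> /eqP->; rewrite ?mulrNN mulr1. Qed.

Lemma pm1_neq0 a : pm1 a -> a != 0.
Proof. by case/orP=> /eqP->; rewrite ?oppr_eq0 oner_eq0. Qed.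

Lemma pm1_conj a : pm1 a -> a^* = a.
Proof. by case/orP=> /eqP->; rewrite ?rmorphN /= conjC1. Qed.

Lemma pm1_sgn z o : pm1 (sgn z o).
Proof.
rewrite /sgn; elim/big_rec: _ => [|p a _ IHa]; first by rewrite /pm1 eqxx.
by apply: pm1_mul => //; case: (_ && _); rewrite /pm1 eqxx ?orbT.
Qed.

Lemma sgn_xorr z o x : sgn z (xorf o x) = sgn z o * sgn z x.
Proof.
rewrite /sgn -big_split; apply: eq_bigr => p _ /=; rewrite ffunE.
by case: (z p) (o p) (x p) => [] [] []; rewrite /= ?mulrNN ?mulr1 ?mul1r.
Qed.

Lemma sgnC z o : sgn z o = sgn o z.
Proof. by apply: eq_bigr => p _; rewrite andbC. Qed.

Lemma sgn_xorl z y o : sgn (xorf z y) o = sgn z o * sgn y o.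
Proof. by rewrite sgnC sgn_xorr !(sgnC o). Qed.

Section Expectation.
Variables (J : finType) (Phi : J -> {ffun I -> bool} -> F).

(* [sum_j <Phi_j| T |Phi_j>] for the real Pauli string T = Z^z X^x. *)
Definition pauli_ev x z : F :=
  \sum_j \sum_o sgn z o * Phi j (xorf o x) * (Phi j o)^*.

Lemma pauli_ev0 : pauli_ev [ffun => false] [ffun => false] =
  \sum_j \sum_o Phi j o * (Phi j o)^*.
Proof.
apply: eq_bigr => j _; apply: eq_bigr => o _.
rewrite /sgn big1 ?mul1r => [|p _]; last by rewrite ffunE.
by rewrite (_ : xorf o _ = o) //; apply/ffunP => p; rewrite !ffunE addbF.
Qed.

Hypothesis Phi1 : \sum_j \sum_o Phi j o * (Phi j o)^* = 1.

(** With $T = Z^z X^x$, expanding gives $\sum_j \|T\Phi_j - ev\,\Phi_j\|^2 = 1 - 2\,ev^2 + 1 = 0$,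
    so every term vanishes. *)
Lemma pauli_ev_eigen x z : pm1 (pauli_ev x z) ->
  forall j o, sgn z o * Phi j (xorf o x) = pauli_ev x z * Phi j o.
Proof.
set ev := pauli_ev x z => ev_pm1.
pose D j o := sgn z o * Phi j (xorf o x) - ev * Phi j o.
have D_ge0 j o : 0 <= D j o * (D j o)^* by exact: mul_conjC_ge0.
have sumD0 : \sum_j \sum_o D j o * (D j o)^* = 0.
  have -> : \sum_j \sum_o D j o * (D j o)^* =
      \sum_j \sum_o Phi j (xorf o x) * (Phi j (xorf o x))^*
      - ev * ev - ev * ev^* + \sum_j \sum_o Phi j o * (Phi j o)^*.
    rewrite {2 4}/ev /pauli_ev rmorph_sum /= !mulr_sumr -!sumrB -big_split /=.
    apply: eq_bigr => j _; rewrite rmorph_sum /= !mulr_sumr -!sumrB -big_split /=.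
    apply: eq_bigr => o _; rewrite /D.
    rewrite rmorphB !rmorphM /= (pm1_conj ev_pm1) (pm1_conj (pm1_sgn z o)) conjCK.
    have s2 := pm1_sqr (pm1_sgn z o); have e2 := pm1_sqr ev_pm1.
    set s := sgn z o in s2 *; set a := Phi j _; set b := Phi j o.
    transitivity ((s * s) * (a * a^*) - ev * (s * a * b^*) -
      ev * (s * a^* * b) + (ev * ev) * (b * b^*)); first by ring.
    by rewrite s2 e2 !mul1r.
  have -> : \sum_j \sum_o Phi j (xorf o x) * (Phi j (xorf o x))^* = 1.
    rewrite -[RHS]Phi1; apply: eq_bigr => j _.
    by rewrite [RHS](reindex_inj (inv_inj (xorfK x))).
  by rewrite Phi1 (pm1_conj ev_pm1) (pm1_sqr ev_pm1); ring.
move=> j o; apply/eqP; rewrite -subr_eq0 -/(D j o) -mul_conjC_eq0; apply/eqP.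
have sum_ge0 i : true -> 0 <= \sum_o D i o * (D i o)^* by move=> _; apply: sumr_ge0.
have Dj : \sum_o D j o * (D j o)^* = 0 by exact: (psumr_eq0P sum_ge0 sumD0).
have term_ge0 p : true -> 0 <= D j p * (D j p)^* by [].
exact: (psumr_eq0P term_ge0 Dj).
Qed.

(** The two eigenvector equations are applied in turn; [sgn z' x] arises from moving $Z^{z'}$ past
    $X^x$. *)
Lemma pauli_evM x z x' z' : pm1 (pauli_ev x z) -> pm1 (pauli_ev x' z') ->
  pauli_ev (xorf x x') (xorf z z') =
    sgn z' x * (pauli_ev x z * pauli_ev x' z').
Proof.
move=> /pauli_ev_eigen E /pauli_ev_eigen E'.
rewrite -[RHS]mulr1 -Phi1 mulr_sumr; apply: eq_bigr => j _.
rewrite mulr_sumr; apply: eq_bigr => o _; rewrite mulrA; congr (_ * _).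
have := E' j (xorf o x); rewrite -xorfA sgn_xorr => E'o.
have {}E'o : sgn z' o * Phi j (xorf o (xorf x x')) =
    sgn z' x * (pauli_ev x' z' * Phi j (xorf o x)).
  rewrite -E'o -[LHS]mul1r -(pm1_sqr (pm1_sgn z' x)); ring.
rewrite sgn_xorl -mulrA E'o.
transitivity (sgn z' x * pauli_ev x' z' * (sgn z o * Phi j (xorf o x))).
  by ring.
by rewrite E; ring.
Qed.

Lemma pm1_pauli_evM x z x' z' : pm1 (pauli_ev x z) -> pm1 (pauli_ev x' z') ->
  pm1 (pauli_ev (xorf x x') (xorf z z')).
Proof.
move=> E E'; rewrite pauli_evM //.
by apply: pm1_mul; [exact: pm1_sgn | exact: pm1_mul].
Qed.

(** Both orders of multiplication give the same string, with nonzero value, so the reordering signs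
    agree: two strings of value $\pm 1$ cannot anticommute. *)
Lemma pauli_ev_commute x z x' z' : pm1 (pauli_ev x z) -> pm1 (pauli_ev x' z') ->
  sgn z' x = sgn z x'.
Proof.
move=> E E'; have := pauli_evM E E'.
rewrite xorfC [xorf z z']xorfC pauli_evM // [pauli_ev x' z' * _]mulrC.
by move/mulIf => -> //; apply/pm1_neq0/pm1_mul.
Qed.

End Expectation.
End PauliStrings.

(** Distributivity over joint Kraus indices and outcomes: the passage from local Heisenberg images
    to the Schrödinger picture. *)
Lemma prod_pauli_expand (F : numClosedFieldType) (I : finType) (M : nat)
    (f g : I -> 'I_M -> bool -> F) (x z : {ffun I -> bool}) :
  \prod_p \sum_k \sum_o (-1) ^+ (z p && o) * f p k (o (+) x p) * (g p k o)^* =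
  \sum_(k : {ffun I -> 'I_M}) \sum_(o : {ffun I -> bool})
    sgn F z o * (\prod_p f p (k p) (xorf o x p)) * (\prod_p g p (k p) (o p))^*.
Proof.
rewrite bigA_distr_bigA /=; apply: eq_bigr => k _.
rewrite bigA_distr_bigA /=; apply: eq_bigr => o _.
rewrite rmorph_prod /sgn -!big_split /=.
by apply: eq_bigr => p _; rewrite ffunE.
Qed.

(** * Two copies of a network and their rewirings *)

Section Inflation.
Variables (N S : nat) (a b : 'I_S -> 'I_N) (d1 d2 : 'I_S -> nat).
Variable rho : forall s : 'I_S, dop (slot (d1 s) (d2 s)).

Local Notation conf := (srcconf d1 d2).
Local Notation conf2 := {ffun bool -> conf}.
Local Notation party2 := ('I_N * bool)%type.
Local Notation wiring := ('I_N -> 'I_S -> bool).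

Implicit Types (Q : wiring) (U : 'I_S -> bool) (c : conf) (cc : conf2).

Definition touches (X : 'I_N) (s : 'I_S) := (a s == X) || (b s == X).

(* Party [X] of copy [i] is fed by source [s] of copy [Q X s (+) i]; this
   function gives the configuration of sources seen by that party. *)
Definition view Q X i cc : conf := [ffun s => cc (Q X s (+) i) s].

Definition swap U cc : conf2 := [ffun i => [ffun s => cc (U s (+) i) s]].

Definition src_state2 cc cc' : Cplx := \prod_i src_state rho (cc i) (cc' i).

(* A string on ['I_N], with the observable of party [X] placed in copy [f X]. *)
Definition place (f : 'I_N -> bool) (x : {ffun 'I_N -> bool})
  : {ffun party2 -> bool} := [ffun p => x p.1 && (p.2 == f p.1)].

Lemma agree_onP X c c' :
  reflect (forall s, (a s = X -> (c s).1 = (c' s).1)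
                  /\ (b s = X -> (c s).2 = (c' s).2))
          (agree_on a b X c c').
Proof.
apply: (iffP forallP) => [H s | H s].
  by have /andP[/implyP H1 /implyP H2] := H s;
    split=> /eqP E; apply/eqP; [apply: H1 | apply: H2].
have [H1 H2] := H s.
by apply/andP; split; apply/implyP => /eqP E; apply/eqP; [apply: H1 | apply: H2].
Qed.

Lemma agree_on_sym X c c' : agree_on a b X c c' = agree_on a b X c' c.
Proof.
by apply/agree_onP/agree_onP => H s; have [H1 H2] := H s;
  split=> E; rewrite ?H1 ?H2.
Qed.

Lemma agree_on_view X Q Q' i cc :
  (forall s, touches X s -> Q X s = Q' X s) ->
  agree_on a b X (view Q X i cc) (view Q' X i cc).
Proof.
move=> QQ'; apply/agree_onP => s; rewrite !ffunE.
by split=> E; rewrite QQ' // /touches E eqxx ?orbT.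
Qed.

(** In every wiring the two copies of [X] jointly receive the same subsystems; only their
    distribution between the copies changes. *)
Lemma agree_on_views X Q Q' cc cc' :
  (forall i, agree_on a b X (view Q X i cc) (view Q X i cc')) ->
  forall i, agree_on a b X (view Q' X i cc) (view Q' X i cc').
Proof.
move=> H i; apply/agree_onP => s; rewrite !ffunE.
have /agree_onP/(_ s) := H (Q X s (+) (Q' X s (+) i)).
by rewrite !ffunE addKb.
Qed.

Lemma swapK U : involutive (swap U).
Proof.
move=> cc; apply/ffunP => i; rewrite ffunE; apply/ffunP => s.
by rewrite !ffunE addKb.
Qed.

Lemma view_swap U Q X i cc :
  view Q X i (swap U cc) = view (fun X s => U s (+) Q X s) X i cc.
Proof. by apply/ffunP => s; rewrite !ffunE addbA. Qed.

(** The two copies of a source are independent and in the same state. *)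
Lemma src_state2_swap U cc cc' :
  src_state2 (swap U cc) (swap U cc') = src_state2 cc cc'.
Proof.
rewrite /src_state2 /src_state exchange_big [RHS]exchange_big /=.
apply: eq_bigr => s _; rewrite !big_bool /= !ffunE.
by case: (U s) => //=; rewrite mulrC.
Qed.

Lemma src_state2_gram : (forall s, is_state (@rho s)) -> is_gram src_state2.
Proof.
move=> rho_state; apply: (@is_gram_prod _ _ _
  (fun i (cc cc' : conf2) => src_state rho (cc i) (cc' i))) => i.
apply: (@is_gram_pullback _ _ _ (fun cc : conf2 => cc i) (src_state rho)).
apply: (@is_gram_prod _ _ _ (fun s c c' => rho (c s) (c' s))) => s.
apply: (@is_gram_pullback _ _ _ (fun c : conf => c s) (@rho s)).
by apply: psd_gram; case: (rho_state s).
Qed.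

Section Channels.
Variables (M : nat) (K : 'I_N -> 'I_M -> bool -> conf -> Cplx).
Hypothesis K_channel : forall X, local_channel a b X (K X).

(* Heisenberg-picture image of the Pauli operator Z^z X^x under the channel of
   party [X]. *)
Definition heis X (x z : bool) c c' : Cplx :=
  \sum_k \sum_o (-1) ^+ (z && o) * K X k (o (+) x) c * (K X k o c')^*.

Definition net_ev (x z : {ffun 'I_N -> bool}) : Cplx :=
  \sum_c \sum_c' src_state rho c c' * \prod_X heis X (x X) (z X) c c'.

Definition infl_ev Q (x z : {ffun party2 -> bool}) : Cplx :=
  \sum_cc \sum_cc' src_state2 cc cc' * \prod_X \prod_i
    heis X (x (X, i)) (z (X, i)) (view Q X i cc) (view Q X i cc').

Lemma heis_id X c c' :
  heis X false false c c' = (agree_on a b X c c')%:R.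
Proof.
have [_ /(_ c' c)] := K_channel X; rewrite agree_on_sym.
rewrite (_ : (if _ then _ else _) = (agree_on a b X c c')%:R); last by case: ifP.
move=> <-; apply: eq_bigr => k _; apply: eq_bigr => o _.
by rewrite addbF mul1r mulrC.
Qed.

Lemma heis_local X x z c c' d d' :
  agree_on a b X c d -> agree_on a b X c' d' ->
  heis X x z c c' = heis X x z d d'.
Proof.
move=> cd c'd'; have [K_local _] := K_channel X.
apply: eq_bigr => k _; apply: eq_bigr => o _.
by rewrite (K_local k _ c d) // (K_local k _ c' d').
Qed.

(** Exchanging the copies of the sources in [U] shifts all wirings at once. This moves a rewiring
    from one end of a source to the other. *)
Lemma infl_ev_swap U Q x z :
  infl_ev Q x z = infl_ev (fun X s => U s (+) Q X s) x z.
Proof.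
rewrite /infl_ev (reindex_inj (inv_inj (swapK U))); apply: eq_bigr => cc _.
rewrite (reindex_inj (inv_inj (swapK U))); apply: eq_bigr => cc' _.
rewrite src_state2_swap; congr (_ * _).
by apply: eq_bigr => X _; apply: eq_bigr => i _; rewrite !view_swap.
Qed.

(** Where both observables of a party are trivial, trace preservation turns its channels into
    agreement tests that do not see the wiring; elsewhere locality of the channel suffices. *)
Lemma infl_ev_rewire Q Q' (x z : {ffun party2 -> bool}) :
  (forall X, (forall i, x (X, i) = false /\ z (X, i) = false) \/
             (forall s, touches X s -> Q X s = Q' X s)) ->
  infl_ev Q x z = infl_ev Q' x z.
Proof.
move=> QQ'; apply: eq_bigr => cc _; apply: eq_bigr => cc' _; congr (_ * _).
apply: eq_bigr => X _; have [xz0 | QX] := QQ' X; last first.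
  by apply: eq_bigr => i _; apply: heis_local; apply: agree_on_view.
have idE Q1 :
    \prod_i heis X (x (X, i)) (z (X, i)) (view Q1 X i cc) (view Q1 X i cc') =
    ([forall i, agree_on a b X (view Q1 X i cc) (view Q1 X i cc')])%:R.
  rewrite (eq_bigr (fun i =>
    (agree_on a b X (view Q1 X i cc) (view Q1 X i cc'))%:R)); last first.
    by move=> i _; have [-> ->] := xz0 i; rewrite heis_id.
  case: forallP => [H | /forallP]; first by rewrite big1 // => i _; rewrite H.
  by rewrite negb_forall => /existsP[i /negPf H]; rewrite (bigD1 i) //= H mul0r.
rewrite !idE; congr (_ %:R); congr nat_of_bool.
by apply/forallP/forallP; apply: agree_on_views.
Qed.

(** Renaming the two copies of a party complements its wiring. *)
Lemma infl_ev_flip (f : 'I_N -> bool) Q (x z : {ffun party2 -> bool}) :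
  infl_ev Q [ffun p => x (p.1, f p.1 (+) p.2)] [ffun p => z (p.1, f p.1 (+) p.2)]
  = infl_ev (fun X s => f X (+) Q X s) x z.
Proof.
apply: eq_bigr => cc _; apply: eq_bigr => cc' _; congr (_ * _).
apply: eq_bigr => X _; rewrite (reindex_inj (inv_inj (addKb (f X)))) /=.
apply: eq_bigr => i _; rewrite !ffunE /= addKb.
by congr heis; apply/ffunP => s; rewrite !ffunE addbCA addbA.
Qed.

(** Unravelling into pure states: a Gram vector of the sources and a choice of Kraus operators label
    an unnormalised vector, so the eigenvector argument applies to rewired networks. *)
Lemma infl_ev_gram (R : finType) (w : R -> conf2 -> Cplx) Q x z :
  (forall cc cc', src_state2 cc cc' = \sum_r w r cc * (w r cc')^*) ->
  infl_ev Q x z = pauli_ev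
    (fun (kr : {ffun party2 -> 'I_M} * R) o =>
       \sum_cc w kr.2 cc * \prod_p K p.1 (kr.1 p) (o p) (view Q p.1 p.2 cc))
    x z.
Proof.
move=> wE.
pose G (k : {ffun party2 -> 'I_M}) (o : {ffun party2 -> bool}) cc :=
  \prod_p K p.1 (k p) (o p) (view Q p.1 p.2 cc).
transitivity (\sum_cc \sum_cc' \sum_r \sum_k \sum_o
    (w r cc * (w r cc')^*) * (sgn Cplx z o * G k (xorf o x) cc * (G k o cc')^*)).
  apply: eq_bigr => cc _; apply: eq_bigr => cc' _.
  rewrite pair_bigA /= wE mulr_suml; apply: eq_bigr => r _.
  have := prod_pauli_expand (fun p k o => K p.1 k o (view Q p.1 p.2 cc))
    (fun p k o => K p.1 k o (view Q p.1 p.2 cc')) x z.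
  rewrite (eq_bigr (fun p => heis p.1 (x (p.1, p.2)) (z (p.1, p.2))
    (view Q p.1 p.2 cc) (view Q p.1 p.2 cc'))) => [->|[] //].
  by rewrite mulr_sumr; apply: eq_bigr => k _; rewrite mulr_sumr.
rewrite /pauli_ev -(pair_bigA _ (fun k r => \sum_o sgn Cplx z o *
  (\sum_cc w r cc * G k (xorf o x) cc) * (\sum_cc w r cc * G k o cc)^*)) /=.
under eq_bigr do rewrite exchange_big /=.
rewrite exchange_big /=.
under eq_bigr do under eq_bigr do rewrite exchange_big /=.
under eq_bigr do rewrite exchange_big /=.
rewrite exchange_big /=; apply: eq_bigr => k _; apply: eq_bigr => r _.
under eq_bigr do rewrite exchange_big /=.
rewrite exchange_big /=; apply: eq_bigr => o _.
rewrite -mulrA mulr_suml mulr_sumr; apply: eq_bigr => cc _.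
rewrite rmorph_sum /= !mulr_sumr; apply: eq_bigr => cc' _.
by rewrite rmorphM /=; ring.
Qed.

Lemma net_evE x z :
  net_ev x z = \sum_o sgn Cplx z o * network_output K (src_state rho) (xorf o x) o.
Proof.
transitivity (\sum_c \sum_c' \sum_(k : {ffun 'I_N -> 'I_M}) \sum_o
    src_state rho c c' * (sgn Cplx z o *
    (\prod_X K X (k X) (xorf o x X) c) * (\prod_X K X (k X) (o X) c')^*)).
  apply: eq_bigr => c _; apply: eq_bigr => c' _.
  have -> := prod_pauli_expand (fun X k o => K X k o c) (fun X k o => K X k o c') x z.
  by rewrite mulr_sumr; apply: eq_bigr => k _; rewrite mulr_sumr.
under eq_bigr do under eq_bigr do rewrite exchange_big /=.
under eq_bigr do rewrite exchange_big /=.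
rewrite exchange_big /=; apply: eq_bigr => o _; rewrite /network_output mulr_sumr.
under eq_bigr do rewrite exchange_big /=.
rewrite exchange_big /=; apply: eq_bigr => k _.
rewrite mulr_sumr; apply: eq_bigr => c _.
by rewrite mulr_sumr; apply: eq_bigr => c' _; ring.
Qed.

(** By trace preservation [K] disappears, so the trace is common to all terms of a mixture. *)
Lemma net_ev0 : net_ev [ffun => false] [ffun => false] =
  \sum_c \sum_c' src_state rho c c' * \prod_X (agree_on a b X c c')%:R.
Proof.
apply: eq_bigr => c _; apply: eq_bigr => c' _; congr (_ * _).
by apply: eq_bigr => X _; rewrite !ffunE heis_id.
Qed.

(** Without rewiring the copies are independent, and the second one contributes only its trace. *)
Lemma infl_ev_place0 x z :
  infl_ev (fun _ _ => false) (place (fun=> false) x) (place (fun=> false) z) =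
  net_ev x z * net_ev [ffun => false] [ffun => false].
Proof.
have view0 X i cc : view (fun _ _ => false) X i cc = cc i.
  by apply/ffunP => s; rewrite ffunE.
pose E i := if i then net_ev [ffun => false] [ffun => false] else net_ev x z.
transitivity (\prod_i E i); last by rewrite big_bool /= mulrC.
pose T i c c' := src_state rho c c' *
  \prod_X heis X (x X && (i == false)) (z X && (i == false)) c c'.
transitivity (\prod_i \sum_c \sum_c' T i c c').
  rewrite bigA_distr_bigA; apply: eq_bigr => cc _.
  rewrite bigA_distr_bigA; apply: eq_bigr => cc' _.
  rewrite big_split /= [X in _ = _ * X]exchange_big /=; congr (_ * _).
  by apply: eq_bigr => X _; apply: eq_bigr => i _; rewrite !view0 !ffunE.
apply: eq_bigr => -[] _; apply: eq_bigr => c _; apply: eq_bigr => c' _;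
  by congr (_ * _); apply: eq_bigr => X _; rewrite ?ffunE ?andbT ?andbF.
Qed.

End Channels.
End Inflation.

(* The expectation values [W Q] of real Pauli strings in two copies of a network
   rewired according to [Q]. *)
Lemma two_copy_inflation (N : nat) (psi : qubits N -> Cplx) :
  \sum_x psi x * (psi x)^* = 1 -> preparable_bipartite (proj_of psi) ->
  exists (S : nat) (a b : 'I_S -> 'I_N)
    (W : ('I_N -> 'I_S -> bool) ->
       {ffun 'I_N * bool -> bool} -> {ffun 'I_N * bool -> bool} -> Cplx),
  [/\ forall x z,
        W (fun _ _ => false) (place (fun=> false) x) (place (fun=> false) z)
        = pauli_ev (fun _ : unit => psi) x z,
      forall Q, exists (J : finType)
          (Phi : J -> {ffun 'I_N * bool -> bool} -> Cplx),
        \sum_j \sum_o Phi j o * (Phi j o)^* = 1 /\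
        forall x z, W Q x z = pauli_ev Phi x z,
      forall U Q x z, W Q x z = W (fun X s => U s (+) Q X s) x z,
      forall Q Q' (x z : {ffun 'I_N * bool -> bool}),
        (forall X, (forall i, x (X, i) = false /\ z (X, i) = false) \/
                   (forall s, touches a b X s -> Q X s = Q' X s)) ->
        W Q x z = W Q' x z
    & forall (f : 'I_N -> bool) Q (x z : {ffun 'I_N * bool -> bool}),
        W Q [ffun p => x (p.1, f p.1 (+) p.2)] [ffun p => z (p.1, f p.1 (+) p.2)]
        = W (fun X s => f X (+) Q X s) x z].
Proof.
move=> psi1 [S [a [b [d1 [d2 [rho [rho_state]]]]]]].
case=> L [p [M [K [p_ge0 [p_sum1 [K_channel psiE]]]]]].
pose W Q x z := \sum_l p l * infl_ev rho (K l) Q x z.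
have psi_ev x z :
    \sum_l p l * net_ev rho (K l) x z = pauli_ev (fun _ : unit => psi) x z.
  rewrite /pauli_ev big_const card_unit /= addr0.
  under eq_bigr do rewrite net_evE mulr_sumr.
  rewrite exchange_big; apply: eq_bigr => o _ /=.
  rewrite -mulrA -[psi _ * _]/(proj_of psi (xorf o x) o) psiE mulr_sumr.
  by apply: eq_bigr => l _; rewrite mulrCA.
have psi_ev0 : pauli_ev (fun _ : unit => psi) [ffun => false] [ffun => false] = 1.
  by rewrite pauli_ev0 big_const card_unit /= addr0.
pose t := \sum_c \sum_c' src_state rho c c' * \prod_X (agree_on a b X c c')%:R.
have netE l : net_ev rho (K l) [ffun => false] [ffun => false] = t.
  exact: net_ev0.
(* As [t] does not depend on [l], it is the trace of the whole mixture, which is the squared norm of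
   [psi]. *)
have t1 : t = 1.
  rewrite -psi_ev0 -psi_ev -[LHS]mul1r -p_sum1 mulr_suml.
  by apply: eq_bigr => l _; rewrite netE.
have W0 x z :
    W (fun _ _ => false) (place (fun=> false) x) (place (fun=> false) z) =
    pauli_ev (fun _ : unit => psi) x z.
  rewrite -psi_ev; apply: eq_bigr => l _.
  by rewrite infl_ev_place0 netE t1 mulr1.
have W_rewire Q Q' (x z : {ffun 'I_N * bool -> bool}) :
    (forall X, (forall i, x (X, i) = false /\ z (X, i) = false) \/
               (forall s, touches a b X s -> Q X s = Q' X s)) ->
    W Q x z = W Q' x z.
  move=> QQ'; apply: eq_bigr => l _.
  by rewrite (infl_ev_rewire _ (K_channel l) QQ').
exists S, a, b, W; split=> // [Q | U Q x z | f Q x z]; last 2 first.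
- by apply: eq_bigr => l _; rewrite (infl_ev_swap _ _ U).
- by apply: eq_bigr => l _; rewrite infl_ev_flip.
have [R [w wE]] := src_state2_gram rho_state.
(* The square roots of the weights are absorbed into the vectors, so that one family describes the
   mixture. *)
pose Phi (j : 'I_L * ({ffun 'I_N * bool -> 'I_M} * R)) o := sqrtC (p j.1) *
  \sum_cc w j.2.2 cc * \prod_q K j.1 q.1 (j.2.1 q) (o q) (view Q q.1 q.2 cc).
have WE x z : W Q x z = pauli_ev Phi x z.
  rewrite /pauli_ev -(pair_bigA _ (fun l j => \sum_o
    sgn Cplx z o * Phi (l, j) (xorf o x) * (Phi (l, j) o)^*)) /=.
  apply: eq_bigr => l _; rewrite (infl_ev_gram _ _ _ _ wE) mulr_sumr.
  apply: eq_bigr => j _; rewrite mulr_sumr; apply: eq_bigr => o _.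
  rewrite /Phi rmorphM /= -[in LHS](sqrtCK (p l)) expr2.
  have /CrealP -> : sqrtC (p l) \is Num.real by rewrite ger0_real ?sqrtC_ge0.
  by ring.
exists _, Phi; split=> //.
(* The total squared norm is the value of the identity string, which no rewiring affects. *)
have := W0 [ffun => false] [ffun => false]; rewrite psi_ev0.
have -> : place (fun=> false) [ffun => false] =
    [ffun => false] :> {ffun 'I_N * bool -> bool}.
  by apply/ffunP => q; rewrite !ffunE.
rewrite (W_rewire _ Q) => [|X]; last by left=> i; rewrite !ffunE.
by rewrite WE pauli_ev0.
Qed.

Lemma sgn_single (F : numClosedFieldType) (I : finType) (p0 : I)
    (z o : {ffun I -> bool}) :
  (forall p, p != p0 -> z p && o p = false) ->
  sgn F z o = (-1) ^+ (z p0 && o p0).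
Proof.
by move=> zo; rewrite /sgn (bigD1 p0) //= big1 ?mulr1 // => p /zo ->.
Qed.

Lemma place_xorf (N : nat) (f : 'I_N -> bool) (x y : {ffun 'I_N -> bool}) :
  place f (xorf x y) = xorf (place f x) (place f y).
Proof.
by apply/ffunP => p; rewrite !ffunE; case: (x _) (y _) (_ == _) => [] [] [].
Qed.

(** A source has only two ends: this is how bipartiteness enters the argument. *)
Lemma touches3 (N S : nat) (a b : 'I_S -> 'I_N) (X Y Z : 'I_N) s :
  X != Y -> X != Z -> Y != Z ->
  touches a b X s -> touches a b Y s -> touches a b Z s -> False.
Proof.
rewrite /touches => XY XZ YZ.
by move=> /orP[]/eqP EX /orP[]/eqP EY /orP[]/eqP EZ;
  move: XY XZ YZ; rewrite -EX -EY -EZ ?eqxx.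
Qed.

(** * Stabilizer elements of a graph state and the contradiction by inflation *)

Section Stabilizers.
Variables (N : nat) (e : rel 'I_N).
Hypotheses (e_sym : symmetric e) (e_irr : irreflexive e).
Variable psi : qubits N -> Cplx.
Hypothesis psi_graph : is_graph_state_vector e psi.

(* [g_i] is the Pauli string with X part [genX i] and Z part [genZ i]. *)
Definition genX (i : 'I_N) : {ffun 'I_N -> bool} := [ffun v => v == i].
Definition genZ (i : 'I_N) : {ffun 'I_N -> bool} := [ffun v => e i v].

Lemma psi_norm1 : \sum_o psi o * (psi o)^* = 1.
Proof.
by have [<- _] := psi_graph; apply: eq_bigr => o _; rewrite mulrC.
Qed.

Lemma pauli_ev_gen i : pauli_ev (fun _ : unit => psi) (genX i) (genZ i) = 1.
Proof.
rewrite /pauli_ev big_const card_unit /= addr0 -psi_norm1.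
apply: eq_bigr => o _; congr (_ * _).
have [_ /(_ i) g_psi] := psi_graph; rewrite -[in RHS]g_psi /gop /Xop.
have -> : xorf o (genX i) = flip i o.
  by apply/ffunP => v; rewrite !ffunE; case: eqP; rewrite ?addbT ?addbF.
have foldE (r : seq 'I_N) y : foldr (fun j phi => Zop j phi) psi r y =
    (\prod_(j <- r) (-1) ^+ (y j)) * psi y.
  elim: r => [|j r IHr]; first by rewrite big_nil mul1r.
  by rewrite big_cons /= /Zop IHr mulrA.
rewrite foldE; congr (_ * _); rewrite big_enum_cond /= big_mkcond /=.
(* [gop] takes the signs at the flipped label; this is harmless because [i] is not its own
   neighbour. *)
apply: eq_bigr => j _; rewrite !ffunE inE andbT.
by case: eqP => [->|_]; case: ifP => // /idP; rewrite ?e_irr.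
Qed.

Lemma pm1_gen i : pm1 (pauli_ev (fun _ : unit => psi) (genX i) (genZ i)).
Proof. by rewrite pauli_ev_gen /pm1 eqxx. Qed.

Lemma pm1_psiM x z x' z' :
  pm1 (pauli_ev (fun _ : unit => psi) x z) ->
  pm1 (pauli_ev (fun _ : unit => psi) x' z') ->
  pm1 (pauli_ev (fun _ : unit => psi) (xorf x x') (xorf z z')).
Proof.
by apply: pm1_pauli_evM; rewrite big_const card_unit /= addr0 psi_norm1.
Qed.

(** At [A] the element $g_A g_C$ is $Y$ up to a phase, so the parity hypothesis says that the string
    [(x3, z3)] anticommutes with it there. *)
Lemma not_preparable_of_stabilizer (A B C : 'I_N) (x3 z3 : {ffun 'I_N -> bool}) :
  e A B -> e B C -> e A C ->
  pm1 (pauli_ev (fun _ : unit => psi) x3 z3) -> z3 A (+) x3 A ->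
  (forall v, v != A -> v != B -> v != C -> e A v != e C v ->
     x3 v = false /\ z3 v = false) ->
  ~ preparable_bipartite (proj_of psi).
Proof.
move=> eAB eBC eAC ev3 odd3 disj3 prep.
have [S [a [b [W [W0 WE W_swap W_rewire W_flip]]]]] :=
  two_copy_inflation psi_norm1 prep.
have neq X Y : e X Y -> X != Y by apply: contraTneq => ->; rewrite e_irr.
have AB := neq _ _ eAB; have BC := neq _ _ eBC; have AC := neq _ _ eAC.
pose t X s := touches a b X s.
pose x1 := xorf (genX A) (genX B); pose z1 := xorf (genZ A) (genZ B).
pose x2 := xorf (genX B) (genX C); pose z2 := xorf (genZ B) (genZ C).
pose x12 := xorf x1 x2; pose z12 := xorf z1 z2.
pose in0 := @place N (fun=> false).
have in0E x X i : in0 x (X, i) = x X && ~~ i by rewrite ffunE eqbF_neg.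
have in0_id (x z : {ffun 'I_N -> bool}) X : x X = false -> z X = false ->
    forall i, in0 x (X, i) = false /\ in0 z (X, i) = false.
  by move=> xX zX i; rewrite !in0E xX zX.
have x12E v : x12 v = (v == A) (+) (v == C).
  by rewrite !ffunE; case: (v == A) (v == B) (v == C) => [] [] [].
have z12E v : z12 v = e A v (+) e C v.
  by rewrite !ffunE; case: (e A v) (e B v) (e C v) => [] [] [].
(* Cut: [C] receives its sources shared with [A] from the other copy. *)
pose cut (X : 'I_N) (s : 'I_S) := (X == C) && t A s.
(* Only [C] is rewired; $g_A g_B$ is trivial on it because its two $Z$ factors cancel. *)
have cut1 : pm1 (W cut (in0 x1) (in0 z1)).
  rewrite (W_rewire _ (fun _ _ => false)) => [|X].
    by rewrite W0; apply: pm1_psiM; apply: pm1_gen.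
  rewrite /cut; have [->|_] := eqVneq X C; last by right.
  left; apply: in0_id; rewrite !ffunE.
    by rewrite ![C == _]eq_sym (negPf AC) (negPf BC).
  by rewrite eAC eBC.
(* Swapping the sources between [A] and [C] moves the cut to [A], where $g_B g_C$ is trivial; no
   third party touches these sources. *)
have cut2 : pm1 (W cut (in0 x2) (in0 z2)).
  rewrite (W_swap (fun s => t A s && t C s)).
  rewrite (W_rewire _ (fun _ _ => false)) => [|X].
    by rewrite W0; apply: pm1_psiM; apply: pm1_gen.
  have [->|XA] := eqVneq X A.
    left; apply: in0_id; rewrite !ffunE; first by rewrite (negPf AB) (negPf AC).
    by rewrite ![e _ A]e_sym eAB eAC.
  right=> s tX; rewrite /cut; have [XC|XC] := eqVneq X C.
    by rewrite -XC /t tX andbT addbb.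
  rewrite addbF; apply/negP => /andP[tA tC].
  exact: (touches3 XA XC AC tX tA tC).
have cut12 : pm1 (W cut (in0 x12) (in0 z12)).
  have [J [Phi [Phi1 PhiE]]] := WE cut.
  rewrite /in0 (place_xorf _ x1 x2) (place_xorf _ z1 z2) PhiE; rewrite !PhiE in cut1 cut2.
  exact: (pm1_pauli_evM Phi1 cut1 cut2).
(* Inside the second inflation, [gA gC] uses [C] of the other copy, which is
   connected to the vertices [out] of its support, whereas [(x3, z3)] uses [C]
   of the first copy, connected to everything else. *)
pose out v := [&& v != A, v != B, v != C & e A v != e C v].
pose tout s := [exists v, out v && t v s].
have outA : out A = false by rewrite /out eqxx.
have outC : out C = false by rewrite /out eqxx !andbF.
have out_neq v X : out v -> out X = false -> v != X.
  by move=> ov oX; apply/eqP => vX; rewrite vX oX in ov.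
pose big (X : 'I_N) (s : 'I_S) := (X == C) && tout s.
have big3 : pm1 (W big (in0 x3) (in0 z3)).
  (* This swap moves the rewiring from [C] to the vertices in [out], where [(x3, z3)] is trivial. *)
  rewrite (W_swap (fun s => tout s && t C s)).
  rewrite (W_rewire _ (fun _ _ => false)) ?W0 // => X.
  have [/and4P[XA XB XC eX] | /negbTE oX] := boolP (out X).
    by left; apply: in0_id; have [] := disj3 X XA XB XC eX.
  right=> s tX; rewrite /big; have [XC|XC] := eqVneq X C.
    by rewrite -XC /t tX andbT addbb.
  rewrite addbF; apply/negP => /andP[/existsP[v /andP[ov tv]] tC].
  exact: (touches3 (out_neq _ _ ov oX) (out_neq _ _ ov outC) XC tv tX tC).
pose f (X : 'I_N) := X == C.
pose fl (x : {ffun 'I_N * bool -> bool}) : {ffun 'I_N * bool -> bool} :=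
  [ffun p => x (p.1, f p.1 (+) p.2)].
have big12 : pm1 (W big (fl (in0 x12)) (fl (in0 z12))).
  (* After the flip, [C] differs from the first copy on all its sources not shared with [out].
     Swapping those not shared with [A] either leaves exactly the wiring [cut] at [C]; any other
     party affected lies outside the support of $g_A g_C$. *)
  rewrite W_flip (W_swap (fun s => [&& t C s, ~~ t A s & ~~ tout s])).
  rewrite (W_rewire _ cut) // => X; rewrite /f /big /cut.
  have [XC|XC] := eqVneq X C.
    right=> s; rewrite XC => tC; rewrite /t tC /=.
    have [/existsP[v /andP[ov tv]] | _] := boolP (tout s); last first.
      by rewrite andbT addbT negbK.
    rewrite andbF; apply/esym/negP => tA.
    exact: (touches3 (out_neq _ _ ov outA) (out_neq _ _ ov outC) AC tv tA tC).
  have [->|XA] := eqVneq X A; first by right=> s tA; rewrite /t tA andbF.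
  have [oX|noX] := boolP (out X).
    right=> s tX; have -> : tout s by apply/existsP; exists X; rewrite oX.
    by rewrite !andbF.
  left; apply: in0_id; first by rewrite x12E (negPf XA) (negPf XC).
  rewrite z12E; have [->|XB] := eqVneq X B; first by rewrite eAB e_sym eBC.
  by move: noX; rewrite /out XA XB XC /= negbK => /eqP ->; rewrite addbb.
have [J [Phi [Phi1 PhiE]]] := WE big; rewrite !PhiE in big3 big12.
(* The strings must commute, yet their signs differ: at [C] they sit in different copies, and on the
   other common vertices apart from [A] no $X$ meets a $Z$. The signs reduce to $(-1)^{x_3(A)}$ and
   $(-1)^{z_3(A)}$. *)
have := pauli_ev_commute Phi1 big3 big12.
have flE x X i : fl (in0 x) (X, i) = x X && ((X == C) == i).
  by rewrite ffunE /= in0E /f; case: (X == C) i => [] [].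
rewrite (@sgn_single _ _ (A, false)) => [|[X i]]; last first.
  rewrite flE in0E z12E; case: i; rewrite ?andbF // eqbF_neg andbT => XA.
  have {}XA : X != A by apply: contraNneq XA => ->.
  have [_|XC] := eqVneq X C; first by rewrite andbF.
  have [->|XB] := eqVneq X B; first by rewrite eAB e_sym eBC.
  have [->|eX] := eqVneq (e A X) (e C X); first by rewrite addbb.
  by have [-> _] := disj3 X XA XB XC eX; rewrite andbF.
rewrite (@sgn_single _ _ (A, false)) => [|[X i]]; last first.
  rewrite flE in0E x12E; case: i; rewrite ?andbF // eqbF_neg andbT => XA.
  have {}XA : X != A by apply: contraNneq XA => ->.
  by rewrite (negPf XA); case: (X == C); rewrite andbF.
rewrite !flE !in0E z12E x12E e_irr [e C A]e_sym eAC eqxx (negPf AC) /= !andbT.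
move: odd3; case: (z3 A) (x3 A) => [] [] //= _ /eqP.
  by rewrite expr0 expr1 -subr_eq0 opprK -(natrD _ 1 1) pnatr_eq0.
by rewrite expr0 expr1 eq_sym -subr_eq0 opprK -(natrD _ 1 1) pnatr_eq0.
Qed.

End Stabilizers.

(** * Neighbourhoods of the triangle vertices *)

Section TriangleConditions.
Variables (N : nat) (e : rel 'I_N) (A B C : 'I_N).

Lemma tri_third X Y : uniq [:: A; B; C] ->
  X \in tri A B C -> Y \in tri A B C -> X != Y ->
  exists2 Z, Z \in tri A B C & (X != Z) && (Y != Z).
Proof.
rewrite /= !inE andbT => /andP[/norP[AB AC] BC].
by case/orP=> [/orP[]|] /eqP-> /orP[/orP[]|] /eqP->; rewrite ?eqxx // => _;
  [exists C | exists B | exists C | exists A | exists B | exists A];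
  rewrite ?inE ?eqxx ?orbT //= ?AB ?AC ?BC // eq_sym ?AB ?AC ?BC // eq_sym.
Qed.

(** Pigeonhole: otherwise a list of length three would contain four distinct vertices. *)
Lemma in_triE X Y Z v : uniq [:: X; Y; Z] ->
  X \in tri A B C -> Y \in tri A B C -> Z \in tri A B C ->
  v \in tri A B C -> [|| v == X, v == Y | v == Z].
Proof.
move=> uXYZ X_tri Y_tri Z_tri v_tri; apply: contraT => vXYZ.
have u4 : uniq [:: v; X; Y; Z] by rewrite cons_uniq uXYZ !inE vXYZ.
suff /(uniq_leq_size u4) : {subset [:: v; X; Y; Z] <= [:: A; B; C]} by [].
move=> u; have -> : (u \in [:: A; B; C]) = (u \in tri A B C) by rewrite !inE orbA.
by rewrite !inE => /or4P[] /eqP->; rewrite -!in_set1 -!in_setU.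
Qed.

Lemma Nprime_Jset X Y Z v : Z \in tri A B C -> v \notin tri A B C ->
  Jset e A B C X Y = set0 -> e X v -> e Y v -> e Z v.
Proof.
move=> Z_tri v_tri J0 eXv eYv; apply: contraT => eZv.
have : v \in Jset e A B C X Y; last by rewrite J0 inE.
have NE W : (v \in Nprime e A B C W) = e W v by rewrite in_setD v_tri inE.
rewrite /Jset /Tset in_setD !in_setI !NE eXv eYv !andbT.
apply: contra eZv => /andP[/andP[eA eB] eC].
by move: Z_tri; rewrite !inE => /orP[/orP[]|] /eqP->.
Qed.

Lemma Nprime_Eset X v : v \notin tri A B C -> Eset e A B C X = set0 -> e X v ->
  exists2 W, W \in tri A B C & (W != X) && e W v.
Proof.
move=> v_tri E0 eXv.
have NE W : (v \in Nprime e A B C W) = e W v by rewrite in_setD v_tri inE.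
have : v \notin Eset e A B C X by rewrite E0 inE.
rewrite in_setD NE eXv andbT negbK => /bigcupP[W].
by rewrite in_setD1 => /andP[WX W_tri]; rewrite NE => eW; exists W; rewrite ?WX.
Qed.

End TriangleConditions.

(** * Choice of the stabilizer element in each of the three cases *)

Theorem theorem3 (N : nat) (e : rel 'I_N)
  (e_sym : symmetric e) (e_irr : irreflexive e)
  (A B C : 'I_N) (hAB : e A B) (hBC : e B C) (hAC : e A C)
  (hcond :
     (exists X Y Z : 'I_N,
        [/\ [&& X \in tri A B C, Y \in tri A B C & Z \in tri A B C],
            [&& X != Y, X != Z & Y != Z],
            Jset e A B C X Y = set0 & Jset e A B C X Z = set0])
     \/ (exists X Y : 'I_N,
        [/\ [&& X \in tri A B C, Y \in tri A B C & X != Y],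
            Eset e A B C X = set0 & Eset e A B C Y = set0])
     \/ (exists X Y : 'I_N,
        [/\ [&& X \in tri A B C, Y \in tri A B C & X != Y],
            Eset e A B C X = set0 & Jset e A B C X Y = set0]))
  (psi : qubits N -> Cplx) (hpsi : is_graph_state_vector e psi) :
  ~ preparable_bipartite (proj_of psi).
Proof.
have neq X Y : e X Y -> X != Y by apply: contraTneq => ->; rewrite e_irr.
have uABC : uniq [:: A; B; C].
  by rewrite /= !inE (negPf (neq _ _ hAB)) (negPf (neq _ _ hAC)) neq.
have adj X Y : X \in tri A B C -> Y \in tri A B C -> X != Y -> e X Y.
  by rewrite !inE => /orP[/orP[]|] /eqP-> /orP[/orP[]|] /eqP->;
    rewrite ?eqxx // e_sym.
have out_tri X Y Z v : uniq [:: X; Y; Z] ->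
    X \in tri A B C -> Y \in tri A B C -> Z \in tri A B C ->
    v != X -> v != Y -> v != Z -> v \notin tri A B C.
  move=> uXYZ X_tri Y_tri Z_tri vX vY vZ.
  apply/negP => /(in_triE uXYZ X_tri Y_tri Z_tri).
  by rewrite (negPf vX) (negPf vY) (negPf vZ).
case: hcond => [[X [Y [Z [/and3P[tX tY tZ] /and3P[XY XZ YZ] JXY JXZ]]]] |].
  have YX : Y != X by rewrite eq_sym.
  (* $g_X$ is tested against $g_Y g_Z$: by the empty sets, an outer neighbour of [X] is adjacent to
     both or neither of [Y] and [Z]. *)
  apply: (not_preparable_of_stabilizer e_sym e_irr hpsi
    (adj _ _ tY tX YX) (adj _ _ tX tZ XZ) (adj _ _ tY tZ YZ)
    (pm1_gen e_irr hpsi X)).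
    by rewrite !ffunE (negPf YX) adj.
  move=> v vY vX vZ eYZ; rewrite !ffunE (negPf vX); split=> //.
  have v_tri : v \notin tri A B C.
    by apply: (out_tri Y X Z) => //; rewrite /= !inE negb_or YX YZ XZ.
  apply: contraNF eYZ => eX; apply/eqP; apply/idP/idP => eW.
    exact: Nprime_Jset tZ v_tri JXY eX eW.
  exact: Nprime_Jset tY v_tri JXZ eX eW.
case=> [[X [Y [/and3P[tX tY XY] EX EY]]] | [X [Y [/and3P[tX tY XY] EX JXY]]]];
  have [Z tZ /andP[XZ YZ]] := tri_third uABC tX tY XY;
  have uXYZ : uniq [:: X; Y; Z] by rewrite /= !inE negb_or XY XZ YZ.
(* $g_X g_Y g_Z$ is tested against $g_X g_Y$: an outer vertex adjacent to exactly one of [X] and [Y]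
   is also adjacent to [Z], so its two $Z$ factors cancel. *)
- have ZY : Z != Y by rewrite eq_sym.
  apply: (not_preparable_of_stabilizer e_sym e_irr hpsi
    (adj _ _ tX tZ XZ) (adj _ _ tZ tY ZY) (adj _ _ tX tY XY)
    (pm1_psiM hpsi (pm1_gen e_irr hpsi X)
      (pm1_psiM hpsi (pm1_gen e_irr hpsi Y) (pm1_gen e_irr hpsi Z)))).
    by rewrite !ffunE eqxx (negPf XY) (negPf XZ) e_irr ![e _ X]e_sym !adj.
  move=> v vX vZ vY eXY; rewrite !ffunE (negPf vX) (negPf vY) (negPf vZ).
  split=> //.
  have v_tri := out_tri X Y Z v uXYZ tX tY tZ vX vY vZ.
  have triE W : W \in tri A B C -> [|| W == X, W == Y | W == Z].
    exact: in_triE.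
  case eX: (e X v) eXY; case eY: (e Y v) => // _.
    have [W tW /andP[WX eW]] := Nprime_Eset v_tri EX eX.
    case/or3P: (triE W tW) => /eqP WE; rewrite WE ?eqxx // in WX eW.
      by rewrite eW in eY.
    by rewrite eW.
  have [W tW /andP[WY eW]] := Nprime_Eset v_tri EY eY.
  case/or3P: (triE W tW) => /eqP WE; rewrite WE ?eqxx // in WY eW.
    by rewrite eW in eX.
  by rewrite eW.
(* $g_X$ is tested against $g_X g_Z$: an outer neighbour of [X] but not of [Z] would be adjacent to
   [Y] since [Eset] is empty, and then to [Z] since [Jset] is empty. *)
apply: (not_preparable_of_stabilizer e_sym e_irr hpsi
  (adj _ _ tX tY XY) (adj _ _ tY tZ YZ) (adj _ _ tX tZ XZ) (pm1_gen e_irr hpsi X)).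
  by rewrite !ffunE eqxx e_irr.
move=> v vX vY vZ eXZ; rewrite !ffunE (negPf vX); split=> //.
have v_tri := out_tri X Y Z v uXYZ tX tY tZ vX vY vZ.
case eX: (e X v) eXZ => // eXZ.
have eZ : e Z v = false by move: eXZ; case: (e Z v).
have [W tW /andP[WX eW]] := Nprime_Eset v_tri EX eX.
case/or3P: (in_triE uXYZ tX tY tZ tW) => /eqP WE; rewrite WE ?eqxx // in WX eW.
  by rewrite (Nprime_Jset tZ v_tri JXY eX eW) in eZ.
by rewrite eW in eZ.
Qed.
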